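(* Let $\Gamma\subset\mathbb{C}$ be a planar lattice. (a) If $\Gamma$ is generic, then $\mathrm{MR}(\Gamma)=\mathbb{Z}$ and $\mathrm{SOS}(\Gamma)=\{\pm 1\}\simeq C_2$. (b) If $\Gamma$ is non-generic, then $\mathcal{O}:=\mathrm{MR}(\Gamma)$ is an order in an imaginary quadratic number field $K$, it satisfies $\mathrm{MR}(\mathcal{O})=\mathcal{O}$, and $$\mathrm{SOS}(\Gamma)=\Bigl\{\tfrac{w}{|w|}\;\Big|\;0\neq w\in\mathcal{O}\Bigr\}.$$ Explicitly, if $\Gamma$ is similar to $\langle 1,\tau\rangle_{\mathbb{Z}}$ with $\tau\in\mathbb{C}\setminus\mathbb{R}$, then $\tau$ is algebraic of degree $2$ over $\mathbb{Q}$ and $\mathcal{O}=\langle 1,s\tau\rangle_{\mathbb{Z}}$ for an appropriate integer $s$. Moreover, $$\mathrm{SOS}(\Gamma)=\mathrm{SOS}(\mathcal{O})=\mathrm{SOS}(\mathcal{O}_K)=\Bigl\{\tfrac{w}{|w|}\;\Big|\;0\neq w\in\mathcal{O}_K\Bigr\},$$ where $\mathcal{O}_K$ is the maximal order of $K$ and contains $\mathcal{O}$, and $\mathrm{SOS}(\cdot)$ is constant on the similarity class of $\Gamma$ (that is, $\mathrm{SOS}(\Gamma')=\mathrm{SOS}(\Gamma)$ for every planar lattice $\Gamma'$ similar to $\Gamma$).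
   Context: A planar lattice is a co-compact discrete subgroup of $\mathbb{C}\cong\mathbb{R}^2$; for $u,v\in\mathbb{C}$, $\langle u,v\rangle_{\mathbb{Z}}:=\mathbb{Z}u+\mathbb{Z}v$. Two planar lattices $\Gamma,\Gamma'\subset\mathbb{C}$ are (properly) similar if $\Gamma'=a\Gamma$ for some nonzero $a\in\mathbb{C}$. The multiplier ring of $\Gamma$ is $\mathrm{MR}(\Gamma):=\{a\in\mathbb{C}\mid a\Gamma\subset\Gamma\}$; it is a subring of $\mathbb{C}$ containing $\mathbb{Z}$. The lattice $\Gamma$ is called generic if $\mathrm{MR}(\Gamma)=\mathbb{Z}$, and non-generic otherwise. An order is a subring of $\mathbb{C}$ that is finitely generated as an additive group; it is an order in its quotient field. The maximal order $\mathcal{O}_K$ of a number field $K$ is its ring of algebraic integers. An order in an imaginary quadratic field $K\subset\mathbb{C}$ is itself regarded as a planar lattice. Here $\mathbb{S}^1$ denotes the unit circle in $\mathbb{C}$, and $$\mathrm{SOS}(\Gamma):=\{z\in\mathbb{S}^1\mid \alpha z\Gamma\subset\Gamma\text{ for some real }\alpha>0\},$$ which is a subgroup of $\mathbb{S}^1$. $C_2$ denotes the cyclic group of order $2$. *)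

(* Defs.v *)
From HB Require Import structures.
From mathcomp Require Import all_boot all_order all_algebra all_field.
From mathcomp Require Import generic_quotient ring_quotient complex.
From mathcomp Require Import boolp classical_sets functions reals topology.
From mathcomp Require Import normedtype.

Set Implicit Arguments.
Unset Strict Implicit.
Unset Printing Implicit Defensive.

Import Order.TTheory GRing.Theory Num.Theory.
Import Quotient.

Local Open Scope classical_set_scope.
Local Open Scope ring_scope.
Local Open Scope complex_scope.

(* The complex plane is [R[i]] over an arbitrary [R : realType].  Its order is
   the partial one of [numClosedFieldType], its norm takes values in [R[i]],
   and its topology is carried by the alias [R[i]^o]. *)

Section PlanarLattices.
Context {R : realType}.
Local Notation C := (R[i]).

(* Co-compactness is compactness of the quotient group C / G for the quotient
   topology; [L] is [G] bundled as an additive subgroup, so that the quotient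
   is available as [quot L]. *)
Definition planar_lattice (G : set C) : Prop :=
  exists L : zmodClosed (C^o),
    [/\ G = [set z | z \in L],
        (G : set (C^o)) `<=` isolated (G : set (C^o)) &
        compact [set: quotient_topology (quot L : quotType (C^o))]].

Definition zspan (m : nat) (s : m.-tuple C) : set C := [set z | inIntSpan s z].

Definition zspan2 (u v : C) : set C := zspan [tuple u; v].

Definition lattice_similar (G G' : set C) : Prop :=
  exists2 a : C, a != 0 & G' = [set a * g | g in G].

Definition MR (G : set C) : set C :=
  [set a | [set a * g | g in G] `<=` G].

Definition integers : set C := range (intr : int -> C).

Definition generic_lattice (G : set C) : Prop := MR G = integers.

Definition S1 : set C := [set z | `|z| = 1].

Definition SOS (G : set C) : set C :=
  [set z | S1 z /\ exists2 alpha : R, 0 < alpha &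
             [set alpha%:C * z * g | g in G] `<=` G].

Definition directions (A : set C) : set C :=
  [set w / `|w| | w in A `\ 0].

(* C_2 is taken in its additive form Z/2Z. *)
Definition isomorphic_to_C2 (A : set C) : Prop :=
  exists f : 'Z_2 -> C,
    {morph f : a b / a + b >-> a * b} /\ set_bij [set: 'Z_2] A f.

Definition is_order (O : set C) : Prop :=
  GRing.subring_closed [pred z | z \in O] /\
  exists (m : nat) (s : m.-tuple C), O = zspan s.

Definition quotient_field (O : set C) : set C :=
  [set z | exists a b, [/\ O a, O b, b != 0 & z = a / b]].

Definition order_in (K O : set C) : Prop :=
  is_order O /\ quotient_field O = K.

(* A number field inside C is the image of a finite extension of Q. *)
Definition number_field (n : nat) (K : set C) : Prop :=
  exists (L : fieldExtType rat) (iota : {rmorphism L -> C}),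
    \dim {:L} = n /\ K = range iota.

Definition imaginary_quadratic (K : set C) : Prop :=
  number_field 2 K /\ ~ (K `<=` [set z | z \is Num.real]).

Definition maximal_order (K : set C) : set C :=
  K `&` [set z | integralOver (intr : int -> C) z].

Definition algebraic_of_degree (n : nat) (z : C) : Prop :=
  exists p : {poly rat},
    [/\ irreducible_poly p, size p = n.+1 & root (map_poly ratr p) z].

End PlanarLattices.

(* Main.v *)
Require Import Defs.
From mathcomp Require Import all_boot all_order all_algebra.
From mathcomp Require Import complex boolp classical_sets functions reals.
From mathcomp Require Import fieldext topology normedtype ring lra zify.
Import Order.TTheory GRing.Theory Num.Theory.
Local Open Scope classical_set_scope.
Local Open Scope ring_scope.
Local Open Scope complex_scope.

(** The rotational part [SOS] is governed by the multiplier ring, for any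
    subset [G] of the plane: if [alpha * z] maps [G] into itself, with [z] on
    the unit circle and [alpha > 0], then [z] is the direction of the
    multiplier [alpha * z], and conversely every nonzero multiplier [w] gives
    the direction [w / |w|] with [alpha = |w|] ([SOS_directions]).  Multiplier
    rings do not change under similarity ([MR_similar]) and a ring containing 1
    is its own multiplier ring ([MR_ring]).  Hence the generic case only asks
    for the directions of the integers, and the other case is about the ring
    [MR Gamma].

    Up to similarity the lattice is [Z + Z tau] with [tau] non-real
    ([planar_lattice_similar]).  This is where discreteness and co-compactness
    enter: the former provides a shortest nonzero element [u] and a shortest
    element [v] off the real line through [u] ([separated_min]), the latter
    ensures that the lattice leaves every such line ([planar_cocompact]).  By
    Gauss reduction, [u] and [v] generate the lattice
    ([lattice_subgroup_reduced]).

    A multiplier of [Z + Z tau] is an element [m + n tau] such that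
    [n tau^2] is again in [Z + Z tau]; the admissible [n] form a subgroup
    [s Z] of [Z], which is nonzero when some multiplier is not an integer.  So
    the multiplier ring is [Z + Z s tau], and the relation
    [s tau^2 = m + n tau] makes [tau] quadratic over [Q] and [w = s tau]
    quadratic and integral ([MR_zspan2], [MR_zspan2_quadratic]).

    Finally [K = Q + Q w] is the image of the field obtained by adjoining to
    [Q] a root of the minimal polynomial of [w] ([rat_plane_number_field]).
    Every element of [K] has a positive integer multiple in [Z + Z w]
    ([rat_plane_scale]); clearing denominators changes no direction, so [K],
    its maximal order and [Z + Z w] all have the same directions, and it also
    shows that [K] is the quotient field of [Z + Z w]. *)

Set Implicit Arguments.
Unset Strict Implicit.
Unset Printing Implicit Defensive.

(** * Discreteness and co-compactness in metric terms *)

Lemma norm_bounded_by_nat (R : realType) (z : R[i]) :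
  exists n : nat, `|z| < n%:R.
Proof.
exists (Num.bound (Num.sqrt (complex.Re z ^+ 2 + complex.Im z ^+ 2))).
rewrite normc_def -(rmorph_nat (real_complex R)) ltcR.
exact/archi_boundP/sqrtr_ge0.
Qed.

Local Open Scope quotient_scope.

(** The images in the quotient of the open disks of integer radius around 0
    increase and exhaust it, so by compactness one of them is the whole
    quotient. *)
Lemma planar_cocompact (R : realType) (G : set R[i]) :
  planar_lattice G ->
  exists M : nat, forall z, exists2 g, G g & `|z - g| < M%:R.
Proof.
move=> [L [-> _ /compact_near_coveringP cpt]].
pose Q := quotient_topology (Quotient.quot L : quotType (R[i]^o)).
have piE x y : \pi_Q x = \pi_Q y -> (x - y) \in L.
  by move=> xy; rewrite Quotient.idealrBE; apply/eqP.
have Epi x y : (x - y) \in L -> \pi_Q x = \pi_Q y.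
  by rewrite Quotient.idealrBE => /eqP xy.
pose P (n : nat) (q : Q) := exists2 z : R[i]^o, `|z| < n%:R & \pi_Q z = q.
have [|n _ nP] := cpt nat (nbhs \oo) P _.
  move=> q _; pose z := repr q : R[i]^o.
  have [n zn] := norm_bounded_by_nat z.
  pose U : set Q := [set \pi_Q x | x in ball z (1 : R[i])].
  exists (U, [set m | (n.+1 <= m)%N]) => /=.
    split; last by exists n.+1.
    suff : @open_nbhs Q q U by move=> /open_nbhs_nbhs.
    split; last first.
      by exists z; [exact: ballxx | rewrite /z reprK].
    (* The preimage of [U] is the union of the translates of the unit disk
       around [z] by elements of [L]; a disk around [y] translates to [x]. *)
    rewrite /open /= /quotient_open openE => x [y zy /piE yx].
    have /nbhs_ballP[e /= e0 eb] : nbhs (y : R[i]^o) (ball z (1 : R[i])).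
      by apply: open_nbhs_nbhs; split => //; exact: ball_open.
    apply/nbhs_ballP; exists e => //= t xt.
    exists (t + (y - x)); last by apply: Epi; rewrite addrAC subrr add0r.
    apply: eb; move: xt; rewrite -!ball_normE /ball_ /=.
    by congr (_ < _); congr (`|_|); ring.
  move=> [q' m] /= [[w zw <-] nm]; exists w => //.
  apply: lt_le_trans (_ : n.+1%:R <= _); last by rewrite ler_nat.
  rewrite -natr1 -[w](subrK z) addrC; apply: le_lt_trans (ler_normD _ _) _.
  apply: ltrD => //; move: zw; rewrite -ball_normE /ball_ /= distrC //.
exists n => z.
have [w wn /piE wz] := nP n (leqnn n) (\pi_Q z) I.
by exists (z - w); [rewrite /= -opprB rpredN | rewrite opprB addrC subrK].
Qed.

Local Close Scope quotient_scope.

(** Shortest elements are compared through the squared modulus because it takes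
    values in the totally ordered [R], unlike the modulus, and is polynomial in
    the coordinates. *)
Definition nsq (R : realType) (z : R[i]) : R :=
  complex.Re z ^+ 2 + complex.Im z ^+ 2.

Lemma nsqM (R : realType) (z w : R[i]) : nsq (z * w) = nsq z * nsq w.
Proof. by case: z w => [a b] [c d]; rewrite /nsq /=; ring. Qed.

Lemma nsq_ge0 (R : realType) (z : R[i]) : 0 <= nsq z.
Proof. by rewrite addr_ge0 ?sqr_ge0. Qed.

Lemma nsq_eq0 (R : realType) (z : R[i]) : (nsq z == 0) = (z == 0).
Proof.
case: z => a b; rewrite /nsq eq_complex /= paddr_eq0 ?sqr_ge0 //.
by rewrite !sqrf_eq0.
Qed.

Lemma nsq_gt0 (R : realType) (z : R[i]) : (0 < nsq z) = (z != 0).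
Proof. by rewrite lt_def nsq_eq0 nsq_ge0 andbT. Qed.

Lemma nsq_lt (R : realType) (z : R[i]) (e : R) :
  0 <= e -> (`|z| < e%:C) = (nsq z < e ^+ 2).
Proof.
move=> e0; rewrite normc_def ltcR -{1}(ger0_norm e0) -sqrtr_sqr.
have [->|e_neq0] := eqVneq e 0.
  by rewrite expr0n sqrtr0 !ltNge sqrtr_ge0 addr_ge0 ?sqr_ge0.
by rewrite ltr_sqrt // exprn_gt0 // lt_def e_neq0.
Qed.

(** The part of [S] in a bounded square is finite: in a grid of mesh [1 / k]
    with [1 <= k] and [2 < k * e], two points of the same cell have squared distance below
    [2 / k ^+ 2 < e], hence are equal.  So a minimum over the finitely many
    occupied cells is a minimum over [S]. *)
Lemma separated_min (R : realType) (S : set R[i]) (e : R) :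
  0 < e -> (forall x y, S x -> S y -> nsq (x - y) < e -> x = y) ->
  S !=set0 -> exists2 x, S x & forall y, S y -> nsq x <= nsq y.
Proof.
move=> e0 sepS [x0 Sx0].
pose c := nsq x0 + 1.
have c0 : 0 < c by rewrite ltr_wpDl ?nsq_ge0.
have [k [ke k1]] : exists k : nat, 2 < k%:R * e /\ 1 <= k%:R :> R.
  exists (Num.bound (2 / e)).+1; split; last by rewrite ler1n.
  rewrite -ltr_pdivrMr //; apply: lt_trans (_ : (Num.bound (2 / e))%:R < _).
    by apply: archi_boundP; apply: ltW; rewrite divr_gt0.
  by rewrite ltr_nat.
(* A point with [nsq z <= nsq x0] has both coordinates in [[-c, c]]. *)
pose M : nat := Num.bound (k%:R * (c + c)).
pose g (x : R) : 'I_M.+1 := inord (Num.truncn (k%:R * (x + c))).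
have gP x : x ^+ 2 <= nsq x0 -> (g x)%:R <= k%:R * (x + c) < (g x)%:R + 1.
  move=> xc.
  have xc' : - c <= x <= c by rewrite /c; apply/andP; split; nra.
  have h0 : 0 <= k%:R * (x + c) by rewrite mulr_ge0 //; lra.
  rewrite natr1 inordK ?truncn_itv // ltnS -(ler_nat R).
  have /andP[h1 _] := truncn_itv h0; apply: le_trans h1 _.
  apply: le_trans (ltW (archi_boundP _)); last by nra.
  by apply: ler_wpM2l; lra.
pose cell (z : R[i]) := (g (complex.Re z), g (complex.Im z)).
pose S' := [set z | S z /\ nsq z <= nsq x0].
have cellI x y : S' x -> S' y -> cell x = cell y -> x = y.
  move=> [Sx xc] [Sy yc] [ga gb]; apply: sepS => //.
  have nsqRe z : nsq z <= nsq x0 -> complex.Re z ^+ 2 <= nsq x0.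
    by apply: le_trans; rewrite lerDl sqr_ge0.
  have nsqIm z : nsq z <= nsq x0 -> complex.Im z ^+ 2 <= nsq x0.
    by apply: le_trans; rewrite lerDr sqr_ge0.
  move: (gP _ (nsqRe _ xc)) (gP _ (nsqIm _ xc)).
  move: (gP _ (nsqRe _ yc)) (gP _ (nsqIm _ yc)).
  rewrite ga gb.
  case: x y {xc yc Sx Sy ga gb} => [a b] [a' b']; rewrite /nsq /=.
  set A : R := (g a')%:R; set B : R := (g b')%:R; set K : R := k%:R in ke k1 *.
  move=> /andP[h1 h2] /andP[h3 h4] /andP[h5 h6] /andP[h7 h8].
  have sq1 (t : R) : -1 < t -> t < 1 -> t ^+ 2 < 1 by move=> ? ?; nra.
  have hX : (K * (a - a')) ^+ 2 < 1 by apply: sq1; lra.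
  have hY : (K * (b - b')) ^+ 2 < 1 by apply: sq1; lra.
  rewrite ltNge; apply/negP => le_e.
  have : K * (K * e) <= K * (K * ((a - a') ^+ 2 + (b - b') ^+ 2)).
    have K0 : 0 <= K by lra.
    by do 2!apply: (ler_wpM2l K0).
  have : K * e <= K * (K * e) by rewrite ler_peMl //; lra.
  lra.
(* [h i] is the unique point in an occupied cell [i]. *)
pose h i := xget 0 [set z | S' z /\ cell z = i].
have hcell z : S' z -> h (cell z) = z.
  move=> Sz; rewrite /h; case: xgetP => [y -> [Sy yz]|/(_ z)[]//].
  exact: cellI.
have S'x0 : S' x0 by [].
have /asboolP Px0 : exists2 z, S' z & cell z = cell x0 by exists x0.
pose P i := `[< exists2 z, S' z & cell z = i >].
have := @arg_minP _ _ _ (cell x0) P (fun i => nsq (h i)) Px0.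
case=> i /asboolP[x S'x <-] xmin; exists x; first by case: S'x.
move=> y Sy; have [yx0|/ltW xy] := leP (nsq y) (nsq x0); last first.
  by apply: le_trans xy; case: S'x.
have S'y : S' y by [].
have := xmin (cell y); rewrite /= !hcell //; apply.
by apply/asboolP; exists y.
Qed.

Lemma planar_subgroup (R : realType) (G : set R[i]) :
  planar_lattice G -> G 0 /\ forall x y, G x -> G y -> G (x - y).
Proof.
move=> [L [-> _ _]]; split; first exact: rpred0.
by move=> x y /= Lx Ly; exact: rpredB.
Qed.

Lemma planar_discrete (R : realType) (G : set R[i]) :
  planar_lattice G ->
  exists2 e : R, 0 < e & forall g, G g -> nsq g < e -> g = 0.
Proof.
move=> PG; have [G0 _] := planar_subgroup PG.
case: PG => [L [_ iso _]].
have [_ [V V0 VG]] := iso 0 G0.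
have [[e e'] /= e0' eV] := (@nbhs_ballP _ (R[i]^o) _ _).1 V0.
have /andP[/eqP e'0 e0] : (e' == 0) && (0 < e) by move: e0'; rewrite ltcE.
rewrite {e' e0'}e'0 -/(e%:C) in eV.
exists (e ^+ 2) => [|g Gg]; first by rewrite exprn_gt0.
rewrite -nsq_lt ?ltW // => ge.
suff : [set (0 : R[i]^o)] g by [].
rewrite -VG; split => //; apply: eV.
by rewrite -ball_normE /ball_ /= sub0r normrN.
Qed.

(** * Gauss reduction of a lattice basis *)

Lemma subgroup_add (V : zmodType) (A : set V) (x y : V) :
  A 0 -> (forall x y, A x -> A y -> A (x - y)) -> A x -> A y -> A (x + y).
Proof.
move=> A0 AB Ax Ay; rewrite -[y]opprK; apply: (AB) => //.
by rewrite -sub0r; exact: AB.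
Qed.

Lemma subgroup_mulz (V : zmodType) (A : set V) (x : V) (m : int) :
  A 0 -> (forall x y, A x -> A y -> A (x - y)) -> A x -> A (x *~ m).
Proof.
move=> A0 AB Ax; have AMn n : A (x *+ n).
  elim: n => [|n IH]; first by rewrite mulr0n.
  by rewrite mulrSr; exact: subgroup_add.
case: m => n; first exact: AMn.
by rewrite NegzE mulrNz -sub0r; exact: AB A0 (AMn n.+1).
Qed.

(** Gauss reduction.  Take [u] shortest among the nonzero elements and
    [v = u * tau] shortest among those off the real line through [u].  Subtract
    from an element [z] the combination of [u] and [v] with the nearest integer
    coordinates: the remainder is [u * h] where [h = a + b * tau] with
    [|a| <= 1/2] and [|b| <= 1/2].  If [b] is nonzero then [h] is not shorter
    than [tau] by minimality of [v]; since minimality against [v + u] and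
    [v - u] gives [|2 Re tau| <= 1] and minimality of [u] gives
    [1 <= |tau|^2], this contradicts
    [|h|^2 = a^2 + 2 a b Re tau + b^2 |tau|^2 <= 1/2 + |tau|^2 / 4].  If [b]
    is zero then [|h| <= 1/2], so [h = 0] by minimality of [u]. *)
Lemma lattice_subgroup_reduced (R : realType) (G : set R[i]) (e : R) :
  G 0 -> (forall x y, G x -> G y -> G (x - y)) ->
  0 < e -> (forall g, G g -> nsq g < e -> g = 0) ->
  (forall u, u != 0 -> exists2 g, G g & g / u \isn't Num.real) ->
  exists u tau, [/\ u != 0, tau \isn't Num.real &
    forall z, G z <-> exists m n : int, z = u * (m%:~R + n%:~R * tau)].
Proof.
move=> G0 GB e0 Ge Gspan.
have GD x y : G x -> G y -> G (x + y) := subgroup_add G0 GB.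
have GM (m : int) x : G x -> G (m%:~R * x).
  by move=> Gx; rewrite mulrzl; exact: subgroup_mulz G0 GB Gx.
have Gmin (S : set R[i]) : S `<=` G -> S !=set0 ->
    exists2 x, S x & forall y, S y -> nsq x <= nsq y.
  move=> SG; apply: (separated_min e0) => x y /SG Gx /SG Gy xy.
  by apply/eqP; rewrite -subr_eq0; apply/eqP/Ge => //; exact: GB.
have [||u [Gu /eqP u0] umin] := Gmin (G `\ 0).
- by move=> x [].
- have [g Gg gnr] := Gspan 1 (oner_neq0 _); exists g; split => //= g0.
  by move: gnr; rewrite g0 mul0r real0.
have [||v [Gv vnr] vmin] := Gmin [set v | G v /\ v / u \isn't Num.real].
- by move=> x [].
- by have [g Gg gnr] := Gspan u u0; exists g.
pose tau := v / u.
have vE : v = u * tau by rewrite /tau mulrC divfK.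
exists u, tau; split => // z; split; last first.
  by move=> [m [n ->]]; rewrite mulrDr mulrCA -vE mulrC; apply: GD; apply: GM.
move=> Gz.
have ge1 w : G (u * w) -> w != 0 -> 1 <= nsq w.
  move=> Gw w0; rewrite -(ler_pMr _ (_ : 0 < nsq u)) ?nsq_gt0 // -nsqM.
  by apply: umin; split => //=; apply/eqP; rewrite mulf_neq0.
have ge_tau w : G (u * w) -> w \isn't Num.real -> nsq tau <= nsq w.
  move=> Gw wnr; rewrite -(ler_pM2l (_ : 0 < nsq u)) ?nsq_gt0 // -!nsqM -vE.
  by apply: vmin; split => //; rewrite mulrC mulKf.
have zE : z = u * (z / u) by rewrite mulrC divfK.
have Gutau : G (u * tau) by rewrite -vE.
have Gcomb w (m n : int) : G (u * w) -> G (u * (w - (m%:~R + n%:~R * tau))).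
  move=> Gw; rewrite mulrBr; apply: GB => //.
  by rewrite mulrDr mulrCA -vE mulrC; apply: GD; apply: GM.
have := Gcomb tau 1 0 Gutau; have := Gcomb tau (-1) 0 Gutau.
have := Gcomb (z / u).
rewrite -zE => /(_ _ _ Gz) Gh G1 G2.
have nearest (x : R) : exists m : int, (x - m%:~R) ^+ 2 <= 4^-1.
  exists (Num.floor (x + 2^-1)); have := floor_itv (x + 2^-1).
  by rewrite intrD; move: (_ %:~R) => m /andP[? ?]; nra.
move: (vnr) ge1 ge_tau (ge1 _ Gutau) Gh zE (ge_tau _ G1) (ge_tau _ G2).
rewrite -/tau.
case: (tau) => r s; case: (z / u) => p q.
rewrite complex_real => s0 ge1 ge_tau N1 Gh zE tau1 tau2.
have [n bn] := nearest (q / s); have [m am] := nearest (p - q / s * r).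
exists m, n; rewrite {1}zE; congr (_ * _).
have := Gh m n; set h := (X in G (u * X)) => {}Gh.
(* With [tau = r + i s] and [z / u = p + i q], the coordinates of [z / u] in
   the real basis [1, tau] are [p - q / s * r] and [q / s]. *)
have hE : h = (p - q / s * r - m%:~R + (q / s - n%:~R) * r)
           +i* ((q / s - n%:~R) * s).
  rewrite /h -!(rmorph_int (real_complex R)); apply/eqP; rewrite eq_complex /=.
  by apply/andP; split; apply/eqP; field.
have r1 : -1 <= 2 * r <= 1.
  move: tau1 tau2; rewrite !mul0r !addr0 mulr1z mulrN1z opprK.
  rewrite -(rmorph1 (real_complex R)) /nsq /= !complex_real.
  rewrite oppr0 !addr0 => /(_ s0) h1 /(_ s0) h2.
  by apply/andP; split; lra.
have {}N1 : 1 <= r ^+ 2 + s ^+ 2.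
  by apply: N1; rewrite eq_complex /= (negPf s0) andbF.
apply/eqP; rewrite -subr_eq0 -/h; apply/negPn/negP => h_neq0.
have := ge1 _ Gh h_neq0; have := ge_tau _ Gh; rewrite hE /nsq complex_real /=.
move: am bn; set a := p - _ - _; set b := q / s - _ => am bn.
have [->|b0] := eqVneq b 0; first by rewrite !mul0r => _; lra.
rewrite mulf_neq0 // => /(_ isT) le_h _.
have ab : (2 * (a * b)) ^+ 2 <= 2^-1 ^+ 2.
  have := ler_pM (sqr_ge0 a) (sqr_ge0 b) am bn; rewrite -exprMn; lra.
have {}ab : -2^-1 <= 2 * (a * b) <= 2^-1 by apply/andP; split; nra.
have abr : 2 * (a * b) * r <= 4^-1.
  by case/andP: ab r1 => ? ? /andP[? ?]; nra.
have bN : b ^+ 2 * (r ^+ 2 + s ^+ 2) <= 4^-1 * (r ^+ 2 + s ^+ 2).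
  by apply: ler_wpM2r => //; lra.
lra.
Qed.

Lemma planar_lattice_basis (R : realType) (G : set R[i]) :
  planar_lattice G ->
  exists u tau, [/\ u != 0, tau \isn't Num.real &
    forall z, G z <-> exists m n : int, z = u * (m%:~R + n%:~R * tau)].
Proof.
move=> PG; have [G0 GB] := planar_subgroup PG.
have [e e0 Ge] := planar_discrete PG.
apply: lattice_subgroup_reduced G0 GB e0 Ge _ => u u0.
have [M PM] := planar_cocompact PG.
(* A point orthogonal to [u], at distance [M] from the line through [u]. *)
have [g Gg gM] := PM (u * (0 +i* (M%:R / Num.sqrt (nsq u)))).
exists g => //; apply/negP => /complex_realP[k gk].
have gE : g = u * (k +i* 0) by rewrite complexr0 -gk mulrC divfK.
move: gM; rewrite gE -mulrBr -(rmorph_nat (real_complex R)) nsq_lt ?ler0n //.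
rewrite nsqM {2}/nsq /= sub0r oppr0 addr0 sqrrN exprMn exprVn sqr_sqrtr.
  rewrite mulrDr [_ * (_ / _)]mulrC divfK ?nsq_eq0 // ltNge => /negP; apply.
  by rewrite lerDr mulr_ge0 ?nsq_ge0 ?sqr_ge0.
exact: nsq_ge0.
Qed.

(** * Multiplier rings and directions *)

Lemma zspan2P (R : realType) (u v z : R[i]) :
  zspan2 u v z <-> exists m n : int, z = m%:~R * u + n%:~R * v.
Proof.
split=> [[a ->]|[m [n ->]]].
  rewrite big_ord_recr big_ord1 /=.
  by exists (a (widen_ord (leqnSn 1) ord0)), (a ord_max); rewrite !mulrzl.
exists [ffun i : 'I_2 => if i == ord0 then m else n].
by rewrite big_ord_recr big_ord1 /= !ffunE /= !mulrzl.
Qed.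

Lemma direction_scale (R : realType) (d w : R[i]) :
  0 < d -> d * w / `|d * w| = w / `|w|.
Proof.
move=> d0; rewrite normrM gtr0_norm // invfM mulrACA divff ?mul1r //.
exact: lt0r_neq0.
Qed.

(** A rotation [z] with factor [alpha > 0] is the direction of the multiplier
    [alpha * z]; a nonzero multiplier [w] has factor [|w|]. *)
Lemma SOS_directions (R : realType) (G : set R[i]) : SOS G = directions (MR G).
Proof.
apply/seteqP; split => [z [z1 [a a0 aG]]|_ [w [Gw /eqP w0] <-]].
  have {}z1 : `|z| = 1 := z1.
  have aC0 : 0 < a%:C :> R[i] by rewrite ltcR.
  exists (a%:C * z); last by rewrite direction_scale // z1 divr1.
  split => //= /eqP; rewrite mulf_eq0 (gt_eqF aC0) -normr_eq0 /=.
  by rewrite z1 oner_eq0.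
have nw0 : `|w| != 0 by rewrite normr_eq0.
split; first by rewrite /S1 /= normrM normfV normr_id divff.
have wR : (complex.Re `|w|)%:C = `|w| by rewrite RRe_real // normr_real.
exists (complex.Re `|w|); first by rewrite -ltcR wR normr_gt0.
by rewrite wR mulrC divfK.
Qed.

Lemma directions_mono (R : realType) (A B : set R[i]) :
  A `<=` B -> directions A `<=` directions B.
Proof. by move=> AB _ [w [/AB Bw w0] <-]; exists w. Qed.

Lemma MR_scale (R : realType) (a : R[i]) (G : set R[i]) :
  a != 0 -> MR [set a * g | g in G] = MR G.
Proof.
move=> a0; apply/seteqP; split => b bG _ [g Gg <-].
  have [g' Gg' /(mulfI a0) <- //] : [set a * g | g in G] (a * (b * g)).
  by rewrite mulrCA; apply: bG; exists (a * g) => //; exists g.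
case: Gg => h Gh <-; rewrite mulrCA; exists (b * h) => //.
by apply: bG; exists h.
Qed.

Lemma MR_similar (R : realType) (G G' : set R[i]) :
  lattice_similar G G' -> MR G' = MR G.
Proof. by case=> a a0 ->; exact: MR_scale. Qed.

(** A multiplier of [A] sends 1 into [A]. *)
Lemma MR_ring (R : realType) (A : set R[i]) :
  A 1 -> (forall x y, A x -> A y -> A (x * y)) -> MR A = A.
Proof.
move=> A1 AM; apply/seteqP; split => x Ax.
  by rewrite -[x]mulr1; apply: Ax; exists 1.
by move=> _ [y Ay <-]; exact: AM.
Qed.

Lemma MR_1 (R : realType) (G : set R[i]) : MR G 1.
Proof. by move=> _ [g Gg <-]; rewrite mul1r. Qed.

Lemma MR_mul (R : realType) (G : set R[i]) x y :
  MR G x -> MR G y -> MR G (x * y).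
Proof.
move=> Gx Gy _ [g Gg <-]; rewrite -mulrA; apply: Gx; exists (y * g) => //.
by apply: Gy; exists g.
Qed.

Lemma MR_sub (R : realType) (G : set R[i]) x y :
  (forall g h, G g -> G h -> G (g - h)) -> MR G x -> MR G y -> MR G (x - y).
Proof.
move=> GB Gx Gy _ [g Gg <-]; rewrite mulrBl.
by apply: GB; [apply: Gx|apply: Gy]; exists g.
Qed.

Lemma MR_MR (R : realType) (G : set R[i]) : MR (MR G) = MR G.
Proof. by apply: MR_ring; [exact: MR_1 | exact: MR_mul]. Qed.

Lemma directions_integers (R : realType) :
  directions (integers : set R[i]) = [set 1; -1].
Proof.
apply/seteqP; split => [_ [_ [[k _ <-] /eqP k0] <-]|_ [->|->]].
- have [kp|kn|k00] := ltgtP k 0.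
  + right; rewrite ltr0_norm ?ltrz0 //= invrN mulrN divff //.
  + left; rewrite gtr0_norm ?ltr0z //= divff //.
  + by rewrite k00 eqxx in k0.
- exists 1; last by rewrite normr1 divr1.
  by split; [exists 1 | apply/eqP; rewrite oner_neq0].
- exists (-1); last by rewrite normrN1 divr1.
  by split; [exists (-1) | apply/eqP; rewrite oppr_eq0 oner_neq0].
Qed.

Lemma signs_C2 (R : realType) : isomorphic_to_C2 ([set 1; -1] : set R[i]).
Proof.
exists (fun i : 'Z_2 => (-1) ^+ i); split.
  by move=> [[|[|//]] ?] [[|[|//]] ?] /=;
    rewrite ?expr0 ?expr1 ?mulr1 ?mul1r ?mulrNN ?mulr1.
have n1 : (1 : R[i]) <> -1.
  by move=> /eqP; rewrite -addr_eq0 (_ : 1 + 1 = 2%:R) // pnatr_eq0.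
split.
- by move=> [[|[|//]] ?] _ /=; [left|right].
- move=> [[|[|//]] ?] [[|[|//]] ?] _ _ /=; rewrite ?expr0 ?expr1 => h.
  + exact: val_inj.
  + by case: n1.
  + by case: n1.
  + exact: val_inj.
- by move=> _ [->|->]; [exists 0 | exists 1].
Qed.

(** * The multiplier ring of a non-generic lattice *)

Lemma int_subgroup_principal (D : set int) (k : int) :
  (forall m n, D m -> D n -> D (m - n)) -> D k -> k != 0 ->
  exists2 s : int, s != 0 & forall n, D n <-> exists q, n = q * s.
Proof.
move=> DB Dk k0.
have D0 : D 0 by rewrite -(subrr k); exact: DB.
have DM q n : D n -> D (q * n).
  by move=> Dn; have := subgroup_mulz q D0 DB Dn; rewrite mulrzz mulrC.
have pos_exists : exists j : nat, (0 < j)%N && `[< D j%:Z >].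
  exists `|k|%N; rewrite absz_gt0 k0; apply/asboolP.
  rewrite abszE; have [/ger0_norm ->|/ltr0_norm ->] // := leP 0 k.
  by rewrite -sub0r; exact: DB.
have [s /andP[s0 /asboolP Ds] smin] := ex_minnP pos_exists.
exists s%:Z; first by rewrite -lt0n.
move=> n; split=> [Dn|[q ->]]; last exact: DM.
exists (n %/ s)%Z; have nE := divz_eq n s.
have Dr : D (n %% s)%Z.
  by rewrite (_ : (n %% s)%Z = n - (n %/ s)%Z * s); [exact/DB/DM | lia].
have r_ge0 : 0 <= (n %% s)%Z by rewrite modz_ge0 // -lt0n.
have r_lt : (n %% s)%Z < s by rewrite ltz_pmod.
move: r_ge0 r_lt Dr nE; case: (n %% s)%Z => // [[|j]] _ js Dj.
  by rewrite addr0.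
suff : (s <= j.+1)%N by move: js; rewrite ltz_nat ltnNge => /negP.
by apply: smin; rewrite /=; apply/asboolP.
Qed.

Lemma zspan2_sub (R : realType) (u v x y : R[i]) :
  zspan2 u v x -> zspan2 u v y -> zspan2 u v (x - y).
Proof.
move=> /zspan2P[m [n ->]] /zspan2P[m' [n' ->]]; apply/zspan2P.
by exists (m - m'), (n - n'); rewrite !intrB; ring.
Qed.

Lemma zspan2_mulz (R : realType) (u v x : R[i]) (k : int) :
  zspan2 u v x -> zspan2 u v (k%:~R * x).
Proof.
move=> /zspan2P[m [n ->]]; apply/zspan2P.
by exists (k * m), (k * n); rewrite !intrM; ring.
Qed.

Lemma zspan2_add (R : realType) (u v x y : R[i]) :
  zspan2 u v x -> zspan2 u v y -> zspan2 u v (x + y).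
Proof.
move=> /zspan2P[m [n ->]] /zspan2P[m' [n' ->]]; apply/zspan2P.
by exists (m + m'), (n + n'); rewrite !intrD; ring.
Qed.

Lemma zspan2_l (R : realType) (u v : R[i]) : zspan2 u v u.
Proof. by apply/zspan2P; exists 1, 0; rewrite mul0r mul1r addr0. Qed.

Lemma zspan2_r (R : realType) (u v : R[i]) : zspan2 u v v.
Proof. by apply/zspan2P; exists 0, 1; rewrite mul0r mul1r add0r. Qed.

(** It suffices to test a multiplier on the generators [1] and [tau]. *)
Lemma MR_zspan2P (R : realType) (tau a : R[i]) :
  MR (zspan2 1 tau) a <-> zspan2 1 tau a /\ zspan2 1 tau (a * tau).
Proof.
split=> [aG|[a1 atau] _ [g /zspan2P[m [n ->]] <-]].
  split; last by apply: aG; exists tau => //; exact: zspan2_r.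
  by rewrite -[a]mulr1; apply: aG; exists 1 => //; exact: zspan2_l.
rewrite mulrDr mulr1 mulrC mulrCA.
by apply: zspan2_add; apply: zspan2_mulz.
Qed.

(** [m + n * tau] is a multiplier exactly when [n] lies in the subgroup [D] of
    the integers [n] with [n * tau ^+ 2] in the lattice; [s] generates [D]. *)
Lemma MR_zspan2 (R : realType) (tau : R[i]) :
  tau \isn't Num.real -> MR (zspan2 1 tau) <> integers ->
  exists s : int, [/\ s != 0, zspan2 1 tau (s%:~R * tau ^+ 2) &
                      MR (zspan2 1 tau) = zspan2 1 (s%:~R * tau)].
Proof.
move=> taunr nongen.
pose D : set int := [set n | zspan2 1 tau (n%:~R * tau ^+ 2)].
have MRP (m n : int) : MR (zspan2 1 tau) (m%:~R * 1 + n%:~R * tau) <-> D n.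
  rewrite MR_zspan2P /D /= mulrDl mulr1 -mulrA -expr2; split.
    move=> [_ h]; rewrite -[_ * _](addKr (m%:~R * tau)) addrC.
    by apply: zspan2_sub => //; apply/zspan2_mulz/zspan2_r.
  move=> Dn; split; last by apply: zspan2_add => //; apply/zspan2_mulz/zspan2_r.
  by apply/zspan2P; exists m, n; rewrite mulr1.
have DB m n : D m -> D n -> D (m - n).
  by move=> Dm Dn; rewrite /D /= intrB mulrBl; exact: zspan2_sub.
have [k Dk k0] : exists2 k, D k & k != 0.
  apply: contrapT => noD; apply: nongen.
  apply/seteqP; split => [a aM|_ [m _ <-]].
    have [/zspan2P[m [n aE]] _] := (MR_zspan2P _ _).1 aM.
    have [n0|n0] := eqVneq n 0; last first.
      by case: noD; exists n => //; apply/(MRP m); rewrite -aE.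
    by exists m => //; rewrite aE n0 mulr1 mul0r addr0.
  rewrite -[m%:~R]addr0 -[m%:~R]mulr1 -(mul0r tau); apply/(MRP m 0).
  by rewrite /D /= mul0r; apply/zspan2P; exists 0, 0; rewrite !mul0r addr0.
have [s s0 DE] := int_subgroup_principal DB Dk k0.
exists s; split => //; first by apply/DE; exists 1; rewrite mul1r.
apply/seteqP; split => a.
  move=> aM; have [/zspan2P[m [n aE]] _] := (MR_zspan2P _ _).1 aM.
  rewrite aE in aM *; have /DE[q ->] := (MRP m n).1 aM.
  by apply/zspan2P; exists m, q; rewrite intrM mulrA.
move=> /zspan2P[m [q ->]]; rewrite mulrA -intrM; apply/MRP/DE.
by exists q.
Qed.

Lemma ratr_real (R : realType) (x : rat) : (ratr x : R[i]) \is Num.real.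
Proof. by rewrite /ratr rpredM ?rpredV ?rpred_int. Qed.

(** A rational root [x] would leave [b - x] as the other root, so that both
    roots, hence [w], would be real. *)
Lemma nonreal_quadratic (R : realType) (w : R[i]) (b c : rat) :
  w \isn't Num.real -> w ^+ 2 = ratr b * w + ratr c ->
  let p := 'X^2 - b *: 'X - c%:P in
  [/\ irreducible_poly p, size p = 3%N & root (map_poly ratr p) w].
Proof.
move=> wnr wE p.
have sp : size p = 3%N.
  rewrite /p -addrA -opprD size_polyDl ?size_polyXn // size_polyN.
  apply: leq_ltn_trans (_ : 2 < 3)%N => //.
  rewrite (leq_trans (size_polyD _ _)) // geq_max.
  rewrite (leq_trans (size_scale_leq _ _)) ?size_polyX //.
  by rewrite (leq_trans (size_polyC_leq1 _)).
have rw : root (map_poly ratr p) w.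
  rewrite /root /p !rmorphB /= map_polyXn map_polyZ map_polyX map_polyC /=.
  by rewrite !hornerE wE; apply/eqP; ring.
split => //; apply: cubic_irreducible => [|x]; first by rewrite sp.
apply/negP => rx; case/negP: wnr.
have : (ratr x : R[i]) ^+ 2 = ratr b * ratr x + ratr c.
  have xE : x ^+ 2 = b * x + c.
    move/eqP: rx; rewrite /p !hornerE => h.
    by apply/eqP; rewrite -subr_eq0 -h; apply/eqP; ring.
  by rewrite -rmorphXn /= xE rmorphD rmorphM.
move: wE (ratr_real R x) (ratr_real R b); set X := ratr x.
set B := ratr b => wE Xr Br xE.
have /eqP : (w - X) * (w - (B - X)) = 0.
  transitivity (w ^+ 2 - B * w - (X ^+ 2 - B * X)); first by ring.
  by rewrite wE xE; ring.
by rewrite mulf_eq0 !subr_eq0 => /orP[] /eqP -> //; rewrite rpredB.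
Qed.

(** * The quadratic field and its orders *)

(** The field generated by [w] over the rationals, when [w] is quadratic. *)
Definition rat_plane (R : realType) (w : R[i]) : set R[i] :=
  [set z | exists x y : rat, z = ratr x + ratr y * w].

(** The abstract extension is [Q[X]/(p)] with [p] the minimal polynomial of
    [w], embedded by evaluation at [w].  That evaluation stays in
    [Q + Q w] follows by Horner's rule, as this set is stable under
    multiplication by [w]. *)
Lemma rat_plane_number_field (R : realType) (w : R[i]) (b c : rat) :
  w \isn't Num.real -> w ^+ 2 = ratr b * w + ratr c ->
  number_field 2 (rat_plane w).
Proof.
move=> wnr wE; have [irr_p sp rp] := nonreal_quadratic wnr wE.
set p := _ - _ in irr_p sp rp.
have p0 : p != 0 by rewrite -size_poly_gt0 sp.
pose iota : {rmorphism rat -> R[i]} := ratr.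
pose L := SubFieldExtType (rp : root (map_poly iota p) w) irr_p.
exists L, (@subfx_inj _ _ iota w p : {rmorphism L -> R[i]}); split.
  by rewrite dimvf /dim /= sp.
have injE q : subfx_inj (subfx_eval iota w p q) = (map_poly ratr q).[w].
  exact: subfx_inj_eval.
apply/seteqP; split => [_ [x [y ->]]|_ [z _ <-]].
  exists (subfx_eval iota w p (x%:P + y *: 'X)) => //; apply: etrans (injE _) _.
  by rewrite rmorphD /= map_polyZ map_polyX map_polyC !hornerE.
have [q ->] := subfxE z; suff [x [y qE]] : rat_plane w (map_poly ratr q).[w].
  by exists x, y; apply: etrans (injE _) _.
elim/poly_ind: q => [|q a [x [y qE]]].
  by rewrite map_poly0 horner0; exists 0, 0; rewrite rmorph0 mul0r addr0.
rewrite rmorphD rmorphM /= map_polyX map_polyC !hornerE qE.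
exists (y * c + a), (x + y * b); rewrite !rmorphD !rmorphM /=.
have -> : (ratr x + ratr y * w) * w = ratr x * w + ratr y * w ^+ 2 by ring.
by rewrite wE; ring.
Qed.

Lemma number_field_int (R : realType) (n : nat) (K : set R[i]) (m : int) :
  number_field n K -> K m%:~R.
Proof. by move=> [L [f [_ ->]]]; exists m%:~R => //; rewrite rmorph_int. Qed.

Lemma number_field_mul (R : realType) (n : nat) (K : set R[i]) x y :
  number_field n K -> K x -> K y -> K (x * y).
Proof.
move=> [L [f [_ ->]]] [a _ <-] [b _ <-].
by exists (a * b) => //; rewrite rmorphM.
Qed.

Lemma number_field_div (R : realType) (n : nat) (K : set R[i]) x y :
  number_field n K -> K x -> K y -> K (x / y).
Proof.
move=> [L [f [_ ->]]] [a _ <-] [b _ <-].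
by exists (a / b) => //; rewrite fmorph_div.
Qed.

(** [K] and the algebraic integers both contain 1 and are stable under
    products. *)
Lemma MR_maximal_order (R : realType) (n : nat) (K : set R[i]) :
  number_field n K -> MR (maximal_order K) = maximal_order K.
Proof.
move=> nfK; apply: MR_ring.
  by split; [exact: (number_field_int 1 nfK) | exact: integral1].
move=> x y [Kx Ix] [Ky Iy].
by split; [exact: (number_field_mul nfK) | exact: integral_mul].
Qed.

(** Clearing denominators.  For quadratic [w] the plane is thus the quotient
    field of [Z + Z w]; both have the same directions, as the factor [d] is
    positive. *)
Lemma rat_plane_scale (R : realType) (w z : R[i]) :
  rat_plane w z -> exists2 d : nat, (0 < d)%N & zspan2 1 w (d%:R * z).
Proof.
move=> [x [y ->]].
exists (`|denq x| * `|denq y|)%N; first by rewrite muln_gt0 !absz_gt0 !denq_eq0.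
apply/zspan2P; exists (numq x * denq y), (numq y * denq x).
rewrite natrM !natr_absz !ger0_norm ?denq_ge0 // /ratr !intrM.
by field; rewrite !intr_eq0 !denq_eq0.
Qed.

Lemma zspan2_rat_plane (R : realType) (w : R[i]) :
  zspan2 1 w `<=` rat_plane w.
Proof.
move=> _ /zspan2P[m [n ->]]; exists m%:~R, n%:~R.
by rewrite !ratr_int mulr1.
Qed.

Lemma quotient_field_rat_plane (R : realType) (w : R[i]) (m : nat) :
  number_field m (rat_plane w) -> quotient_field (zspan2 1 w) = rat_plane w.
Proof.
move=> nfK; apply/seteqP; split => [_ [a [b [Oa Ob b0 ->]]]|z Kz].
  by apply: (number_field_div nfK); exact: zspan2_rat_plane.
have [d d0 Odz] := rat_plane_scale Kz.
exists (d%:R * z), d%:R; split => //.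
- by apply/zspan2P; exists d, 0; rewrite mul0r mulr1 addr0.
- by rewrite pnatr_eq0 -lt0n.
- by rewrite mulrC mulKf // pnatr_eq0 -lt0n.
Qed.

Lemma directions_rat_plane (R : realType) (w : R[i]) :
  directions (rat_plane w) `<=` directions (zspan2 1 w).
Proof.
move=> _ [z [/rat_plane_scale[d d0 Odz] /eqP z0] <-].
have dC0 : 0 < d%:R :> R[i] by rewrite ltr0n.
exists (d%:R * z); last by rewrite direction_scale.
by split => //=; apply/eqP; rewrite mulf_neq0 // gt_eqF.
Qed.

Lemma zspan2_integral (R : realType) (w : R[i]) (b c : int) :
  w ^+ 2 = b%:~R * w + c%:~R ->
  zspan2 1 w `<=` [set z | integralOver (intr : int -> R[i]) z].
Proof.
move=> wE.
have Iint m : integralOver (intr : int -> R[i]) m%:~R by exact: integral_id.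
have Iw : integralOver (intr : int -> R[i]) w.
  exists ('X^2 - b *: 'X - c%:P).
    rewrite -addrA -opprD monicE lead_coefDl ?lead_coefXn //.
    rewrite size_polyN size_polyXn.
    rewrite (leq_ltn_trans (size_polyD _ _)) // gtn_max.
    rewrite (leq_ltn_trans (size_scale_leq _ _)) ?size_polyX //=.
    by rewrite (leq_ltn_trans (size_polyC_leq1 _)).
  rewrite /root !rmorphB /= map_polyXn map_polyZ map_polyX map_polyC /=.
  by rewrite !hornerE wE; apply/eqP; ring.
move=> _ /zspan2P[m [n ->]] /=.
by apply: integral_add; rewrite ?mulr1 //; apply: integral_mul.
Qed.

Lemma nonreal_scale (R : realType) (tau : R[i]) (s : int) :
  s != 0 -> tau \isn't Num.real -> s%:~R * tau \isn't Num.real.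
Proof.
move=> s0; apply: contra => str.
have -> : tau = s%:~R * tau / s%:~R by rewrite mulrC mulKf // intr_eq0.
by rewrite rpred_div ?rpred_int.
Qed.

Lemma planar_lattice_similar (R : realType) (G : set R[i]) :
  planar_lattice G ->
  exists2 tau : R[i], tau \isn't Num.real & lattice_similar G (zspan2 1 tau).
Proof.
move=> /planar_lattice_basis[u [tau [u0 taunr GE]]]; exists tau => //.
exists u^-1; first by rewrite invr_eq0.
apply/seteqP; split => [z /zspan2P[m [n ->]]|_ [g /GE[m [n ->]] <-]].
  exists (u * (m%:~R * 1 + n%:~R * tau)); last by rewrite mulKf.
  by apply/GE; exists m, n; rewrite mulr1.
by rewrite mulKf //; apply/zspan2P; exists m, n; rewrite mulr1.
Qed.

(** The relation [s * tau ^+ 2 = m + n * tau] from the multiplier ring, divided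
    by [s], gives the rational equation of [tau]; multiplied by [s], it gives a
    monic integral equation for [s * tau]. *)
Lemma MR_zspan2_quadratic (R : realType) (tau : R[i]) :
  tau \isn't Num.real -> MR (zspan2 1 tau) <> integers ->
  algebraic_of_degree 2 tau /\
  exists2 s : int, s != 0 & MR (zspan2 1 tau) = zspan2 1 (s%:~R * tau) /\
    exists b c : int, (s%:~R * tau) ^+ 2 = b%:~R * (s%:~R * tau) + c%:~R.
Proof.
move=> taunr nongen.
have [s [s0 /zspan2P[m [n sE]] MRE]] := MR_zspan2 taunr nongen.
have sC0 : s%:~R != 0 :> R[i] by rewrite intr_eq0.
split; last first.
  exists s => //; split => //; exists n, (s * m).
  by rewrite exprMn expr2 -mulrA sE intrM; ring.
have tauE : tau ^+ 2 = ratr (n%:~R / s%:~R) * tau + ratr (m%:~R / s%:~R).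
  apply: (mulfI sC0); rewrite sE !fmorph_div !rmorph_int.
  by field.
have [irr sp rt] := nonreal_quadratic taunr tauE.
by eexists; split; [exact: irr | exact: sp | exact: rt].
Qed.

Unset Implicit Arguments.
Set Strict Implicit.

Theorem theorem1 (R : realType) (Gamma : set R[i]) :
  planar_lattice Gamma ->
  (generic_lattice Gamma ->
     [/\ MR Gamma = integers,
         SOS Gamma = [set 1; -1] &
         isomorphic_to_C2 (SOS Gamma)])
  /\
  (~ generic_lattice Gamma ->
     exists K : set R[i],
       (imaginary_quadratic K /\ order_in K (MR Gamma))
       /\ MR (MR Gamma) = MR Gamma
       /\ SOS Gamma = directions (MR Gamma)
       /\ (forall tau : R[i], tau \isn't Num.real ->
             lattice_similar Gamma (zspan2 1 tau) ->
             algebraic_of_degree 2 tau /\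
             exists s : int, MR Gamma = zspan2 1 (s%:~R * tau))
       /\ [/\ SOS Gamma = SOS (MR Gamma),
              SOS (MR Gamma) = SOS (maximal_order K) &
              SOS (maximal_order K) = directions (maximal_order K)]
       /\ MR Gamma `<=` maximal_order K
       /\ (forall Gamma' : set R[i], planar_lattice Gamma' ->
             lattice_similar Gamma Gamma' -> SOS Gamma' = SOS Gamma)).
Proof.
move=> PG; split => [gen|nongen].
  have SOSE : SOS Gamma = [set 1; -1].
    by rewrite SOS_directions gen directions_integers.
  by split => //; rewrite SOSE; exact: signs_C2.
have [tau0 tau0nr sim0] := planar_lattice_similar PG.
have nongen_tau tau :
    lattice_similar Gamma (zspan2 1 tau) -> MR (zspan2 1 tau) <> integers.
  by move=> /MR_similar ->.
have [_ [s s0 []]] := MR_zspan2_quadratic tau0nr (nongen_tau _ sim0).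
rewrite (MR_similar sim0); set w := _ * tau0 => OE [b [c wE]].
have wnr : w \isn't Num.real by exact: nonreal_scale.
have nfK : number_field 2 (rat_plane w).
  by apply: (@rat_plane_number_field _ _ b%:~R c%:~R) => //; rewrite !ratr_int.
have OK : MR Gamma `<=` maximal_order (rat_plane w).
  rewrite OE => z Oz; split; first exact: zspan2_rat_plane.
  exact: (zspan2_integral wE).
exists (rat_plane w); split; first split.
- split => // real_K; have /real_K : rat_plane w w.
    by apply: zspan2_rat_plane; exact: zspan2_r.
  by move=> /= wr; rewrite wr in wnr.
- split; last by rewrite OE; exact: quotient_field_rat_plane nfK.
  split; last by exists 2, [tuple 1; w].
  have [G0 GB] := planar_subgroup PG.
  split; first by rewrite inE; exact: MR_1.
    by move=> x y; rewrite !inE; exact: MR_sub.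
  by move=> x y; rewrite !inE; exact: MR_mul.
split; first exact: MR_MR.
split; first exact: SOS_directions.
split.
  move=> tau taunr sim.
  have [alg [t _ [tE _]]] := MR_zspan2_quadratic taunr (nongen_tau _ sim).
  by split => //; exists t; rewrite -tE (MR_similar sim).
split.
  rewrite !SOS_directions MR_MR (MR_maximal_order nfK); split => //.
  apply/seteqP; split; first exact: directions_mono OK.
  rewrite OE; apply: subset_trans (@directions_rat_plane _ w).
  by apply: directions_mono => z [].
split => // Gamma' _ sim.
by rewrite !SOS_directions (MR_similar sim).
Qed.
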